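(* Fix an integer $k \ge 2$. For a positive integer $N$, let $E_k(N)$ be the number of $k$-tuples $(n_1,\ldots,n_k)\in[1,N]^k$ of integers with $n_1<n_2<\cdots<n_k$ such that the polynomial $F(x) = 1 + x^{n_1}+\cdots+x^{n_k}$, removed of its cyclotomic factors, is reducible over $\mathbb{Q}$. Then $E_k(N) = o(N^k)$ as $N\to\infty$. In other words, for almost all choices of positive integers $n_1<\cdots<n_k$, the polynomial $F(x)$ removed of its cyclotomic factors is irreducible.
   Context: ''Removed of its cyclotomic factors'' means $F(x)$ divided by the product of all its cyclotomic-polynomial factors (with multiplicity) in $\mathbb{Z}[x]$. *)

(* Defs.v *)
From HB Require Import structures.
From mathcomp Require Import all_boot all_order all_algebra all_field.
From mathcomp Require Import boolp.
Set Implicit Arguments. Unset Strict Implicit. Unset Printing Implicit Defensive.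
Import Order.TTheory GRing.Theory Num.Theory.
Local Open Scope ring_scope.

Definition cyclotomic_product (C : {poly int}) : Prop :=
  exists s : seq nat, all (fun n => (0 < n)%N) s /\ C = \prod_(n <- s) 'Phi_n.

Definition noncyclotomic_part (F G : {poly int}) : Prop :=
  (exists C, cyclotomic_product C /\ F = G * C) /\
  (forall n : nat, (0 < n)%N -> ~ exists H : {poly int}, G = 'Phi_n * H).

Definition reducible_over_Q (G : {poly int}) : Prop :=
  let Gq := map_poly (intr : int -> rat) G in
  (1 < size Gq)%N /\ ~ irreducible_poly Gq.

Definition Fpoly (k N : nat) (t : {ffun 'I_k -> 'I_N.+1}) : {poly int} :=
  1 + \sum_(i < k) 'X^(t i).

Definition admissible (k N : nat) (t : {ffun 'I_k -> 'I_N.+1}) : bool :=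
  [forall i : 'I_k, (0 < t i)%N] && [forall i : 'I_k, forall j : 'I_k, (i < j)%N ==> (t i < t j)%N].

Definition bad (k N : nat) (t : {ffun 'I_k -> 'I_N.+1}) : bool :=
  admissible t &&
  `[< exists G, noncyclotomic_part (Fpoly t) G /\ reducible_over_Q G >].

Definition E (k N : nat) : nat := #|[set t : {ffun 'I_k -> 'I_N.+1} | bad t]|.

(* Main.v *)
(** Write [F = 1 + x^n_1 + ... + x^n_k] and suppose that [F = A B] with both factors having
    roots that are not roots of unity. By Ljunggren's trick, [W = A~ B], where [A~] is the
    reversal of [A], satisfies [W W~ = F F~] and [W(1) = F(1)], hence has 0/1 coefficients.
    For all but O(N^(k-1)) tuples, the sums of three elements of [{0, n_1, ..., n_k}] determine
    their summands; the exponents of [W], having the same differences as those of [F], are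
    then forced to be those of [F] or of [F~]. So [A] or [B] is self-reversed, and [F] has a
    root [z], not a root of unity, such that [1/z] is also a root.

    Tuples of the latter kind are counted with [n_1, ..., n_(k-1)] fixed: with
    [F = x^n + g], such a [z] is a root of the nonzero polynomial [x^N (g(x) g(1/x) - 1)], of
    degree at most [2 N], and determines [n] by [z^n = - g(z)]. Either more than [D] roots go
    with [n], which happens for at most [2 N / D] values of [n], or [z] has degree at most [D]
    and conjugates bounded by [k], which leaves a number of possibilities independent of [N]. *)

Require Import Defs.
From HB Require Import structures.
From mathcomp Require Import all_boot all_order all_algebra all_field.
From mathcomp Require Import boolp zify ring lra.
Set Implicit Arguments. Unset Strict Implicit. Unset Printing Implicit Defensive.
Import Order.TTheory GRing.Theory Num.Theory.
Local Open Scope ring_scope.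

Local Notation pZtoQ := (map_poly (intr : int -> rat)).
Local Notation pZtoC := (map_poly (intr : int -> algC)).
Local Notation pQtoC := (map_poly (ratr : rat -> algC)).

(** * Reversed polynomials *)

(** The reversal is relative to a degree bound [n] instead of the size of [p], which makes it
    additive; for [size p <= n.+1] it is X^n p(1/X). *)
Definition recip (R : nzRingType) (n : nat) (p : {poly R}) : {poly R} :=
  \poly_(i < n.+1) p`_(n - i).

Lemma coef_recip (R : nzRingType) n (p : {poly R}) i :
  (recip n p)`_i = if (i <= n)%N then p`_(n - i) else 0.
Proof. by rewrite coef_poly ltnS. Qed.

Lemma recipD (R : nzRingType) n :
  {morph @recip R n : p q / p + q}.
Proof.
by move=> p q; apply/polyP => i; rewrite coefD !coef_recip; case: ifP; rewrite ?coefD ?addr0.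
Qed.

Lemma recip0 (R : nzRingType) n : recip n (0 : {poly R}) = 0.
Proof. by apply/polyP => i; rewrite coef_recip !coef0 if_same. Qed.

Lemma recipZ (R : nzRingType) n a (p : {poly R}) : recip n (a *: p) = a *: recip n p.
Proof.
by apply/polyP => i; rewrite coefZ !coef_recip; case: ifP; rewrite ?coefZ ?mulr0.
Qed.

Lemma recip_sum (R : nzRingType) n (I : Type) (r : seq I) (P : pred I) (f : I -> {poly R}) :
  recip n (\sum_(i <- r | P i) f i) = \sum_(i <- r | P i) recip n (f i).
Proof. exact: (big_morph _ (@recipD R n) (@recip0 R n)). Qed.

Lemma recipXn (R : nzRingType) n i :
  (i <= n)%N -> recip n ('X^i : {poly R}) = 'X^(n - i).
Proof.
move=> lin; apply/polyP => j; rewrite coef_recip !coefXn.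
case: leqP => ljn; first by congr (_%:R); congr nat_of_bool; apply/idP/idP => /eqP ?; apply/eqP; lia.
by case: eqP => // ?; lia.
Qed.

Lemma recipK (R : nzRingType) n (p : {poly R}) :
  (size p <= n.+1)%N -> recip n (recip n p) = p.
Proof.
move=> sp; apply/polyP => i; rewrite !coef_recip leq_subr.
have [lin|lni] := leqP i n; first by rewrite subKn.
by rewrite nth_default // (leq_trans sp).
Qed.

Lemma poly_sumXn (R : nzRingType) n (p : {poly R}) :
  (size p <= n.+1)%N -> p = \sum_(i < n.+1) p`_i *: 'X^i.
Proof.
move=> sp; rewrite -poly_def; apply/polyP => i; rewrite coef_poly.
by case: ltnP => // ni; rewrite nth_default // (leq_trans sp).
Qed.

Lemma recipM (R : comNzRingType) m n (p q : {poly R}) :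
  (size p <= m.+1)%N -> (size q <= n.+1)%N ->
  recip (m + n) (p * q) = recip m p * recip n q.
Proof.
move=> /poly_sumXn {1 2}-> /poly_sumXn {1 2}->.
rewrite mulr_suml !recip_sum mulr_suml; apply: eq_bigr => i _.
rewrite mulr_sumr recip_sum mulr_sumr; apply: eq_bigr => j _.
have [li lj] := (ltn_ord i, ltn_ord j).
rewrite -scalerAl -scalerAr scalerA -exprD !recipZ.
rewrite !recipXn ?leq_add // -scalerAl -scalerAr scalerA -exprD.
by congr (_ *: 'X^_); lia.
Qed.

Lemma map_recip (R S : nzRingType) (f : {rmorphism R -> S}) n (p : {poly R}) :
  map_poly f (recip n p) = recip n (map_poly f p).
Proof.
apply/polyP => i; rewrite coef_map coef_recip /= [RHS]coef_recip coef_map.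
by case: ifP => // _; rewrite rmorph0.
Qed.

Lemma horner_recip (F : fieldType) n (p : {poly F}) x :
  (size p <= n.+1)%N -> x != 0 -> (recip n p).[x] = x ^+ n * p.[x^-1].
Proof.
move=> sp x0; rewrite {1 2}(poly_sumXn sp) recip_sum !horner_sum mulr_sumr.
apply: eq_bigr => i _; have li := ltn_ord i.
rewrite recipZ recipXn // !hornerZ !hornerXn mulrCA; congr (_ * _).
by rewrite exprB ?unitfE // exprVn.
Qed.

Lemma horner1_recip (R : comNzRingType) n (p : {poly R}) :
  (size p <= n.+1)%N -> (recip n p).[1] = p.[1].
Proof.
move=> sp; rewrite {1 2}(poly_sumXn sp) recip_sum !horner_sum.
apply: eq_bigr => i _; have li := ltn_ord i.
by rewrite recipZ recipXn // !hornerZ !hornerXn !expr1n.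
Qed.

Lemma size_recip (R : nzRingType) n (p : {poly R}) : (size (recip n p) <= n.+1)%N.
Proof. exact: size_poly. Qed.

Lemma horner1E (R : nzRingType) n (p : {poly R}) :
  (size p <= n.+1)%N -> p.[1] = \sum_(i < n.+1) p`_i.
Proof.
move=> sp; rewrite {1}(poly_sumXn sp) !horner_sum; apply: eq_bigr => i _.
by rewrite hornerZ hornerXn expr1n mulr1.
Qed.

(** The coefficients of [q - p] are nonnegative and add up to its value at 1, which is 0. *)
Lemma eq_poly_of_le (R : numDomainType) (p q : {poly R}) :
  (forall i, p`_i <= q`_i) -> p.[1] = q.[1] -> p = q.
Proof.
move=> le_pq /eqP; rewrite eq_sym -subr_eq0 -hornerN -hornerD.
set n := size (q - p); rewrite (@horner1E _ n) // psumr_eq0 => [/allP z | i _]; last first.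
  by rewrite coefB subr_ge0.
apply/esym/eqP; rewrite -subr_eq0; apply/eqP/polyP => i; rewrite coef0.
have [lin | lni] := ltnP i n.+1; last by rewrite nth_default // ltnW.
exact/eqP/(z (Ordinal lin))/mem_index_enum.
Qed.

Lemma coef_mul_recip_middle (R : comNzRingType) n (p : {poly R}) :
  (p * recip n p)`_n = \sum_(i < n.+1) p`_i ^+ 2.
Proof.
rewrite coefM; apply: eq_bigr => i _; have li := ltn_ord i.
by rewrite coef_recip leq_subr subKn.
Qed.

(** The middle coefficient is the sum of the squares of the coefficients and [p.[1]] is their sum;
    an integer satisfies x <= x^2, with equality only for 0 and 1. *)
Lemma coefs01_of_norm n (p : {poly int}) :
  (size p <= n.+1)%N -> (p * recip n p)`_n = p.[1] ->
  forall i, p`_i = 0 \/ p`_i = 1.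
Proof.
move=> sp; rewrite coef_mul_recip_middle (horner1E sp) => /eqP.
rewrite -subr_eq0 -sumrB psumr_eq0 => [/allP z i | i _]; last first.
  rewrite expr2 subr_ge0; set x := p`_i.
  have : x <= 0 \/ 1 <= x by lia.
  by case=> ?; nia.
have [lin | lni] := ltnP i n.+1; last by left; rewrite nth_default // (leq_trans sp).
have := z (Ordinal lin) (mem_index_enum _).
rewrite /= expr2 -[X in _ - X]mulr1 -mulrBr mulf_eq0 subr_eq0.
by case/orP => /eqP; [left | right].
Qed.

(** With 0/1 coefficients, the coefficient of degree [n + i - j] counts the pairs of exponents with
    difference [i - j], so no cancellation can occur. *)
Lemma recip_corr_ge n (p : {poly int}) i j :
  (forall e, p`_e = 0 \/ p`_e = 1) -> (i <= n)%N -> (j <= n)%N ->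
  p`_i = 1 -> p`_j = 1 -> 0 < (p * recip n p)`_(n + i - j).
Proof.
move=> p01 lin ljn pi pj; rewrite coefM.
have p0 e : 0 <= p`_e by case: (p01 e) => ->.
have lie : (i < (n + i - j).+1)%N by lia.
rewrite (bigD1 (Ordinal lie)) //= ltr_wpDr //.
  apply: sumr_ge0 => e _; apply: mulr_ge0 => //.
  by rewrite coef_recip; case: ifP.
rewrite /= pi coef_recip mul1r ifT; last by lia.
have -> : (n - (n + i - j - i) = j)%N by lia.
by rewrite pj.
Qed.

Lemma recip_corr_neq0 n (p : {poly int}) e :
  (p * recip n p)`_e != 0 ->
  exists i j : nat, [/\ (j <= n)%N, p`_i != 0, p`_j != 0 & (e + j = n + i)%N].
Proof.
move=> nz; have : [exists i : 'I_e.+1, p`_i * (recip n p)`_(e - i) != 0].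
  apply: contraNT nz => /existsPn z; rewrite coefM big1 // => i _.
  by apply/eqP; move: (z i); rewrite negbK.
case/existsP => i; rewrite mulf_eq0 negb_or coef_recip => /andP[pi].
have li := ltn_ord i.
case: leqP => le; rewrite ?eqxx // => pj.
by exists i, (n - (e - i))%N; split=> //; lia.
Qed.

(** * Sets of exponents with the same differences *)

Definition exponent_poly k (s : 'I_k.+1 -> nat) : {poly int} := \sum_(i < k.+1) 'X^(s i).

(** The exponents form a B_3 set; tuples up to permutation stand for multisets, so repeated summands
    are allowed. *)
Definition sum3_generic k (s : 'I_k.+1 -> nat) : Prop :=
  forall l1 l2 : 3.-tuple 'I_k.+1,
    (\sum_(i <- l1) s i = \sum_(i <- l2) s i)%N -> perm_eq l1 l2.

Lemma sum3_genericP k (s : 'I_k.+1 -> nat) (a b c d e f : 'I_k.+1) :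
  sum3_generic s -> (s a + s b + s c = s d + s e + s f)%N ->
  [:: a; b; c] =i [:: d; e; f].
Proof.
move=> gs eq_s; apply/perm_mem/(gs [tuple a; b; c] [tuple d; e; f]).
by rewrite !big_cons !big_nil !addn0; move: eq_s; rewrite -!addnA.
Qed.

Lemma homometric_exponents k (s : 'I_k.+1 -> nat) (M : pred nat) :
  let n := s ord_max in
  s ord0 = 0%N -> (0 < n)%N -> injective s -> sum3_generic s ->
  M 0%N -> M n -> (forall m, M m -> m <= n)%N ->
  (forall m m', M m -> M m' -> exists i j, m + s j = m' + s i)%N ->
  (forall m, M m -> exists i, m = s i) \/
  (forall m, M m -> exists i, m + s i = n)%N.
Proof.
move=> n s0 n0 injs gs M0 Mn Mle diffM.
have max0 : ord_max != ord0 :> 'I_k.+1.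
  by apply/eqP => E; move: n0; rewrite /n E s0.
(* Both [m - 0] and [n - m] are differences of exponents. Adding the two equations gives a relation
   between sums of three; the index of 0 on one side must be [q] or [j] on the other. *)
have dich m : M m -> (exists i, m = s i) \/ (exists i, m + s i = n)%N.
  move=> Mm; have [i [j e1]] := diffM _ _ Mm M0.
  have [p [q e2]] := diffM _ _ Mn Mm.
  have e3 : (s ord_max + s q + s j = s i + s p + s ord0)%N.
    by rewrite -/n; lia.
  have := sum3_genericP gs e3 ord0.
  rewrite !inE eqxx !orbT eq_sym (negbTE max0) /= => /orP[]/eqP z.
  - by right; exists p; move: e2; rewrite -z s0; lia.
  - by left; exists i; move: e1; rewrite -z s0; lia.
have [allS | nS] := pselect (forall m, M m -> exists i, m = s i); first by left.
right; move/existsNP: nS => [m' /not_implyP[Mm' nsm']].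
have [//|[j m'j]] := dich _ Mm'.
have j0 : j != ord0.
  by apply: contra_notN nsm' => /eqP E; exists ord_max; move: m'j; rewrite E s0; lia.
have jk : j != ord_max.
  apply: contra_notN nsm' => /eqP E; exists ord0; move: m'j.
  by rewrite E s0 -/n; lia.
(* Here [m = s i] while [m' = n - s j] with [j] neither extreme index. Comparing the two forces both
   extreme indices into [i] and [q], so [i] is extreme, and both 0 and [n] are of the form
   [n - s _]. *)
move=> m Mm; have [[i mi] | //] := dich _ Mm.
have [p [q e]] := diffM _ _ Mm Mm'.
have e3 : (s i + s j + s q = s ord_max + s p + s ord0)%N by rewrite -/n; lia.
have := sum3_genericP gs e3 ord0; have := sum3_genericP gs e3 ord_max.
rewrite !inE !eqxx !orbT /= ![_ == j]eq_sym (negbTE j0) (negbTE jk) /=.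
have [E _ _ | _ /=] := eqVneq ord_max i.
  by exists ord0; rewrite s0 addn0 mi -E.
have [E _ _ | _ /=] := eqVneq ord0 i.
  by exists ord_max; rewrite mi -E s0.
by move=> /eqP <-; rewrite eq_sym (negbTE max0).
Qed.

(** The support of [W] is contained in that of [F] or of its reversal; the common value at 1 turns
    the inclusion into equality. *)
Lemma homometric_poly k (s : 'I_k.+1 -> nat) (W : {poly int}) :
  let n := s ord_max in let F := exponent_poly s in
  s ord0 = 0%N -> (0 < n)%N -> injective s -> (forall i, s i <= n)%N ->
  sum3_generic s ->
  (size W <= n.+1)%N -> W * recip n W = F * recip n F -> W.[1] = F.[1] ->
  W = F \/ W = recip n F.
Proof.
move=> n F s0 n0 injs les gs sW eqWF W1.
have coefF e : F`_e = (e \in codom s)%:R.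
  rewrite coef_sum; have [/codomP[i ->] | e_s] := boolP (e \in codom s).
    rewrite (bigD1 i) //= coefXn eqxx big1 ?addr0 // => j ji.
    by rewrite coefXn eq_sym (inj_eq injs) (negbTE ji).
  rewrite big1 // => i _; rewrite coefXn; case: eqP => // E.
  by rewrite E codom_f in e_s.
have sF : (size F <= n.+1)%N.
  apply/leq_sizeP => e le; rewrite coefF; case: codomP => // -[i E].
  by move: le (les i); rewrite E; lia.
have W01 : forall i, W`_i = 0 \/ W`_i = 1.
  apply: coefs01_of_norm sW _; rewrite eqWF coef_mul_recip_middle W1.
  rewrite (horner1E sF); apply: eq_bigr => i _.
  by rewrite coefF; case: (_ \in _); rewrite ?expr0n ?expr1n.
pose M e := W`_e == 1.
have WE e : W`_e = (M e)%:R by rewrite /M; case: (W01 e) => ->.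
have Mle m : M m -> (m <= n)%N.
  rewrite leqNgt => /eqP Wm; apply/negP => nm.
  by move: Wm; rewrite nth_default // (leq_trans sW).
(* The constant coefficient of [W * recip n W] is the product of the coefficients of [W] in degrees
   0 and [n], and for [F] this product is 1. *)
have [M0 Mn] : M 0%N /\ M n.
  have : (W * recip n W)`_0 = 1.
    rewrite eqWF coefM big_ord1 coef_recip /= !subn0 !coefF.
    by rewrite -{1}s0 /n !codom_f.
  rewrite coefM big_ord1 coef_recip /= !subn0 !WE.
  by case: (M 0%N); case: (M n).
have diffM m m' : M m -> M m' -> exists i j, (m + s j = m' + s i)%N.
  move=> Mm Mm'; have [lm lm'] := (Mle _ Mm, Mle _ Mm').
  have := recip_corr_ge W01 lm lm' (eqP Mm) (eqP Mm').
  rewrite eqWF => /lt0r_neq0/recip_corr_neq0[a [b [_]]].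
  rewrite !coefF; case: codomP => // -[i ->] _; case: codomP => // -[j ->] _ e.
  by exists i, j; lia.
have F1 : (recip n F).[1] = F.[1] by exact: horner1_recip.
have [H | H] := homometric_exponents s0 n0 injs gs M0 Mn Mle diffM.
- left; apply: eq_poly_of_le W1 => e; rewrite WE coefF ler_nat.
  by case: (boolP (M e)) => // /H[i ->]; rewrite codom_f.
- right; apply: eq_poly_of_le; rewrite ?F1 // => e.
  rewrite WE; case: (boolP (M e)) => [/H[i ei] | _]; last first.
    by rewrite coef_recip coefF; case: ifP.
  have -> : e = (n - s i)%N by lia.
  by rewrite coef_recip leq_subr subKn // coefF codom_f.
Qed.

(** * Common roots of a polynomial and its reversal *)

Lemma pZtoQtoC (p : {poly int}) : pQtoC (pZtoQ p) = pZtoC p.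
Proof. by rewrite -map_poly_comp; apply: eq_map_poly => b; rewrite /= ratr_int. Qed.

Lemma size_pZtoC (p : {poly int}) : size (pZtoC p) = size p.
Proof. by rewrite size_map_inj_poly ?rmorph0 //; apply: intr_inj. Qed.

(** By Gauss's lemma, a rational divisor is proportional to an integer factor [A]; a constant
    cofactor would make that divisor associated to [G]. *)
Lemma reducible_over_Q_factor (G : {poly int}) : G != 0 -> reducible_over_Q G ->
  exists A B : {poly int}, [/\ G = A * B, (1 < size A)%N & (1 < size B)%N].
Proof.
move=> G0 [sG /not_andP[//|]].
move=> /existsNP[q /not_implyP[sq /not_implyP[dvq neq]]].
case/dvdpP_rat_int: dvq => A [a a0 Dq] [B DG].
have [A0 B0] : A != 0 /\ B != 0.
  by apply/andP; rewrite -negb_or -mulf_eq0 -DG.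
have size_gt1 (p : {poly int}) : p != 0 -> size p != 1%N -> (1 < size p)%N.
  by rewrite -size_poly_gt0; case: (size p) => [|[]].
exists A, B; split=> //; apply: size_gt1 => //.
  by move: sq; rewrite Dq size_scale // size_rat_int_poly.
apply: contra_not_neq neq => /eqP/size_poly1P[c c0 DB].
rewrite Dq DG DB rmorphM /= map_polyC /= mulrC mul_polyC.
apply: eqp_trans (eqp_scale _ a0) _; rewrite eqp_sym.
by apply: eqp_scale; rewrite intr_eq0.
Qed.

(** Over the rationals ['Phi_n] is the minimal polynomial of [z]; as it is monic, the division can
    be carried out over the integers. *)
Lemma Cyclotomic_dvd_of_root (G : {poly int}) n (z : algC) :
  n.-primitive_root z -> root (pZtoC G) z -> exists H, G = 'Phi_n * H.
Proof.
move=> prim_z Gz.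
have [p [Dp _ dv_p]] := minCpolyP z.
have Ep : p = pZtoQ 'Phi_n.
  apply: (map_poly_inj (ratr : {rmorphism rat -> algC})).
  by rewrite -Dp /= pZtoQtoC (Cintr_Cyclotomic prim_z) (minCpoly_cyclotomic prim_z).
have : p %| pZtoQ G by rewrite -dv_p pZtoQtoC.
rewrite Ep dvdp_rat_int => /(Pdiv.IdomainMonic.dvdpP (Cyclotomic_monic n))[H ->].
by exists H; rewrite mulrC.
Qed.

Definition not_unity (z : algC) : Prop := forall m : nat, (0 < m)%N -> z ^+ m != 1.

Lemma noncyclotomic_root (G A B : {poly int}) :
  (forall n : nat, (0 < n)%N -> ~ exists H : {poly int}, G = 'Phi_n * H) ->
  G = A * B -> (1 < size A)%N ->
  exists2 z : algC, root (pZtoC A) z & not_unity z.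
Proof.
move=> noPhi DG sA; have /closed_rootP[z Az] : size (pZtoC A) != 1%N.
  by rewrite size_pZtoC; case: (size A) sA => [|[]].
exists z => // m m0; apply/eqP => /(prim_order_exists m0)[d prim_z _].
apply: (noPhi d (prim_order_gt0 prim_z)); apply: Cyclotomic_dvd_of_root prim_z _.
by rewrite DG rmorphM rootM Az.
Qed.

Lemma root_recip_inv n (p : {poly int}) (z : algC) :
  (size p <= n.+1)%N -> z != 0 -> recip n p = p ->
  root (pZtoC p) z -> root (pZtoC p) z^-1.
Proof.
move=> sp z0 rp; rewrite -{1}rp map_recip /root horner_recip ?size_pZtoC //.
by rewrite mulf_eq0 expf_eq0 (negbTE z0) andbF.
Qed.

Lemma reducible_inverse_roots k (s : 'I_k.+1 -> nat) (G : {poly int}) :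
  let F := exponent_poly s in
  s ord0 = 0%N -> (0 < s ord_max)%N -> injective s -> (forall i, s i <= s ord_max)%N ->
  sum3_generic s -> noncyclotomic_part F G -> reducible_over_Q G ->
  exists z : algC, [/\ z != 0, not_unity z, root (pZtoC F) z & root (pZtoC F) z^-1].
Proof.
move=> F s0 n0 injs les gs [[C [_ DF]] noPhi] redG.
have F00 : F`_0 = 1.
  rewrite coef_sum (bigD1 ord0) //= s0 coefXn eqxx big1 ?addr0 // => i i0.
  by rewrite coefXn -{1}s0 (inj_eq injs) eq_sym (negbTE i0).
have G0 : G != 0.
  by apply: contra_eq_neq F00 => G0; rewrite DF G0 mul0r coef0.
have [A [B [DG sA sB]]] := reducible_over_Q_factor G0 redG.
have FAB : F = A * (B * C) by rewrite DF DG mulrA.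
have DG' : G = B * A by rewrite DG mulrC.
have F0 : F != 0 by apply: contra_eq_neq F00 => ->; rewrite coef0.
have [A0 BC0] : A != 0 /\ B * C != 0.
  by apply/andP; rewrite -negb_or -mulf_eq0 -FAB.
have neq0_root z : root (pZtoC F) z -> z != 0.
  apply: contraTneq => ->; rewrite /root horner_coef0 coef_map /= F00.
  exact: oner_neq0.
set n := s ord_max.
have sF : size F = n.+1.
  apply/eqP; rewrite eqn_leq; apply/andP; split.
    apply/leq_sizeP => e le; rewrite coef_sum big1 // => i _.
    by rewrite coefXn; case: eqP => // E; move: (les i); rewrite -/n; lia.
  rewrite ltnNge; apply/negP => /leq_sizeP/(_ n (leqnn _))/eqP.
  rewrite coef_sum (bigD1 ord_max) //= coefXn eqxx big1 ?addr0 // => i i0.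
  by rewrite coefXn (inj_eq injs) eq_sym (negbTE i0).
set a := (size A).-1; set b := (size (B * C)).-1.
have sAa : (size A <= a.+1)%N by rewrite leqSpred.
have sBb : (size (B * C)%R <= b.+1)%N by rewrite leqSpred.
have Dn : n = (a + b)%N.
  have := sF; rewrite FAB size_mul //; have := size_poly_gt0 A; have := size_poly_gt0 (B * C).
  by rewrite A0 BC0 /a /b; move: (size A) (size _) => x y; lia.
(* The cyclotomic product [C] stays with [B], so that [A] and [B * C] are the two factors of [F] to
   which the reversal trick is applied. *)
pose W := recip a A * (B * C).
have sW : (size W <= n.+1)%N.
  apply: leq_trans (size_polyMleq _ _) _; have := size_recip a A.
  by rewrite Dn; move: (size (recip _ _)) (size _) sBb => x y; lia.
have rF : recip n F = recip a A * recip b (B * C) by rewrite FAB Dn recipM.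
have rW : recip n W = A * recip b (B * C).
  by rewrite Dn recipM ?size_recip // recipK.
have eqWF : W * recip n W = F * recip n F by rewrite rW rF FAB /W; ring.
have W1 : W.[1] = F.[1] by rewrite FAB !hornerM horner1_recip.
have finish P z : P \in [:: A; B * C] -> recip (size P).-1 P = P ->
    root (pZtoC P) z -> not_unity z ->
    exists z : algC, [/\ z != 0, not_unity z, root (pZtoC F) z & root (pZtoC F) z^-1].
  move=> PAB rP Pz uz.
  have PF x : root (pZtoC P) x -> root (pZtoC F) x.
    move: PAB; rewrite !inE FAB rmorphM rootM => /orP[]/eqP-> -> //.
    by rewrite orbT.
  have z0 := neq0_root z (PF z Pz).
  exists z; split; rewrite ?PF //; apply: root_recip_inv rP Pz => //.
  exact: leqSpred.
(* Cancelling [B * C] in [W = F] leaves [A] self-reversed; cancelling [recip a A] in the other case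
   leaves [B * C] self-reversed. The root is then taken from [A], respectively from [B]. *)
have [WF | WF] := homometric_poly s0 n0 injs les gs sW eqWF W1.
- have [z Az uz] := noncyclotomic_root noPhi DG sA.
  apply: (finish A z) => //; rewrite ?inE ?eqxx //.
  by apply: (mulIf BC0); rewrite -FAB.
- have [z Bz uz] := noncyclotomic_root noPhi DG' sB.
  apply: (finish (B * C) z) => //; rewrite ?inE ?eqxx ?orbT //.
    have rA0 : recip a A != 0 by apply: contraNneq A0 => rA; rewrite -(recipK sAa) rA recip0.
    by apply: (mulfI rA0); rewrite -rF.
  by rewrite rmorphM rootM Bz.
Qed.

(** * Counting inverse roots *)

Lemma not_unity_exp_inj (z : algC) : z != 0 -> not_unity z -> injective (fun n => z ^+ n).
Proof.
move=> z0 uz; have le m n : (m <= n)%N -> z ^+ m = z ^+ n -> m = n.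
  move=> lemn /eqP; rewrite -{1}(subnKC lemn) exprD -{1}[z ^+ m]mulr1.
  rewrite (inj_eq (mulfI (expf_neq0 _ z0))) eq_sym => zmn.
  have [] := posnP (n - m); first by lia.
  by move=> /uz; rewrite zmn.
move=> m n; have [lemn | /ltnW lenm] := leqP m n; first exact: le.
by move/esym/(le _ _ lenm).
Qed.

(** Conjugates share their minimal polynomial: that of [x] divides that of [z], and [z] cannot be a
    root of the quotient [r], whose degree is too small. *)
Lemma root_minCpoly_iff (z x : algC) (q : {poly rat}) :
  root (minCpoly z) x -> root (pQtoC q) x = root (pQtoC q) z.
Proof.
have [p [Dp mp] dvp] := minCpolyP z; have [p' [Dp' mp'] dvp'] := minCpolyP x.
rewrite Dp dvp' => p'p; suff E : p' = p by rewrite dvp dvp' E.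
have := p'p; case/dvdpP => r Dr.
have nzr : r != 0 by apply: contraTneq mp => r0; rewrite Dr r0 mul0r monicE lead_coef0 eq_sym oner_eq0.
have : root (pQtoC p) z by rewrite dvp.
rewrite {1}Dr rmorphM rootM !dvp => /orP[pr | pp'].
  have := dvdp_leq nzr pr; rewrite Dr size_mul ?(monic_neq0 mp') //.
  have := size_minCpoly x; rewrite Dp' size_map_poly.
  by move: (size p') (size_poly_gt0 r); rewrite nzr; move: (size r); lia.
by apply/eqP; rewrite -eqp_monic // /eqp p'p.
Qed.

(** If some root were shared with the derivative, so would be its conjugate [z]; then [p] would
    divide its derivative, which is nonzero and of smaller degree. *)
Lemma minCpoly_separable (z : algC) (rs : seq algC) :
  minCpoly z = \prod_(x <- rs) ('X - x%:P) -> uniq rs.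
Proof.
move=> Drs; rewrite -separable_prod_XsubC -Drs separable_poly.unlock.
apply/Pdiv.ClosedField.coprimepP => x px.
have [p [Dp mp] dvp] := minCpolyP z.
rewrite Dp deriv_map; apply: contraTneq isT => /eqP.
rewrite -/(root _ _) (root_minCpoly_iff _ px) dvp => dvp'.
have sp : (1 < size p)%N by have := size_minCpoly z; rewrite Dp size_map_poly.
have p'0 : p^`() != 0.
  apply/eqP => /polyP/(_ (size p).-2); rewrite coef_deriv coef0 => /eqP.
  have -> : (size p).-2.+1 = (size p).-1 by case: (size p) sp => [|[]].
  rewrite -lead_coefE (monicP mp) pnatr_eq0.
  by case: (size p) sp => [|[]].
have := dvdp_leq p'0 dvp'; rewrite leqNgt lt_size_deriv //.
exact: monic_neq0.
Qed.

(** Each further linear factor multiplies the coefficient bound by at most [c + 1]. *)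
Lemma coef_prod_XsubC_le (R : numDomainType) (c : R) (rs : seq R) i :
  0 <= c -> {in rs, forall x, `|x| <= c} ->
  `|(\prod_(x <- rs) ('X - x%:P))`_i| <= (c + 1) ^+ size rs.
Proof.
move=> c0; have c1 : 0 <= c + 1 by rewrite addr_ge0.
elim: rs i => [|x rs IH] i lec.
  by rewrite big_nil coef1; case: eqP => _; rewrite ?normr1 ?normr0 ?ler01.
have {}IH j : `|(\prod_(x <- rs) ('X - x%:P))`_j| <= (c + 1) ^+ size rs.
  by apply: IH => y y_rs; apply: lec; rewrite inE y_rs orbT.
rewrite big_cons mulrBl coefB coefXM coefCM exprS /=.
rewrite addrC mulrDl mul1r; apply: le_trans (ler_normD _ _) _.
rewrite normrN normrM lerD // ?ler_pM ?lec ?mem_head //.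
by case: ifP => _; rewrite ?normr0 ?exprn_ge0.
Qed.

Lemma minCpoly_int (F : {poly int}) (z : algC) :
  F \is monic -> root (pZtoC F) z -> exists w : {poly int}, pZtoC w = minCpoly z.
Proof.
move=> mF Fz; have /floorpP[w ->] : z \in Aint; last by exists w.
apply: root_monic_Aint Fz _ _.
  by rewrite monicE lead_coef_map_inj ?rmorph0 ?(monicP mF) //; exact: intr_inj.
by apply/polyOverP => i; rewrite coef_map /= intr_int.
Qed.

Lemma dvd_minCpoly (F : {poly int}) (z x : algC) :
  root (pZtoC F) z -> root (minCpoly z) x -> root (pZtoC F) x.
Proof. by rewrite -pZtoQtoC => Fz /root_minCpoly_iff->. Qed.

Lemma not_unity_conj (z x : algC) : not_unity z -> root (minCpoly z) x -> not_unity x.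
Proof.
move=> uz zx m m0; have := root_minCpoly_iff ('X^m - 1) zx.
rewrite rmorphB rmorph1 /= map_polyXn /root !hornerE !subr_eq0 => ->.
exact: uz.
Qed.

(** Double counting: each entry of [rs] lies in at most one class. *)
Lemma disjoint_classes_leq (I : finType) (T : eqType) (A : {set I}) (rs : seq T)
    (a : I -> pred T) (D : nat) :
  (forall x, {in A &, forall i j, a i x -> a j x -> i = j}) ->
  {in A, forall i, (D <= count (a i) rs)%N} -> (#|A| * D <= size rs)%N.
Proof.
move=> dis leD; apply: (@leq_trans (\sum_(i in A) count (a i) rs)).
  by rewrite -sum_nat_const leq_sum.
apply: (@leq_trans (\sum_(i in A) \sum_(x <- rs) a i x)).
  by apply: leq_sum => i _; rewrite -sum1_count big_mkcond leq_sum.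
rewrite exchange_big /= -sum1_size; apply: leq_sum => x _.
rewrite -big_mkcondr /= sum1_card.
apply/card_le1_eqP => i j /andP[iA ai] /andP[jA aj].
exact: dis aj ai.
Qed.

(** With B = (c+1)^D, which bounds the coefficients of a monic polynomial of degree at most D with
    roots of modulus at most c, there are 2B+1 choices for each of D+1 coefficients. *)
Definition small_poly_count (c D : nat) : nat := ((c.+1 ^ D).*2.+1 ^ D.+1)%N.

Lemma card_bounded_polys (I : finType) (A : {set I}) (w : I -> {poly int}) (c D : nat) :
  {in A &, injective w} ->
  (forall i, i \in A -> (size (w i) <= D.+1)%N) ->
  (forall i j, i \in A -> `|(w i)`_j| <= (c.+1 ^ D)%N%:R) ->
  (#|A| <= small_poly_count c D)%N.
Proof.
move=> injw szw lew; set B := (c.+1 ^ D)%N in lew *.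
pose h i : {ffun 'I_D.+1 -> 'I_B.*2.+1} := [ffun j : 'I_D.+1 => inord (absz ((w i)`_j + B%:Z))].
have injh : {in A &, injective h}.
  move=> i i' iA i'A /ffunP eqh; apply: injw => //; apply/polyP => j.
  have [ltj | lej] := ltnP j D.+1; last first.
    by rewrite !nth_default // ?(leq_trans _ lej) ?szw.
  have := eqh (Ordinal ltj); rewrite !ffunE /= => /(congr1 val).
  have := lew i j iA; have := lew i' j i'A.
  move: ((w i)`_j) ((w i')`_j) => x y; rewrite pmulrn intz => ly lx.
  rewrite /= !inordK; lia.
rewrite -(card_in_imset injh); apply: leq_trans (max_card _) _.
by rewrite card_ffun !card_ord.
Qed.

Lemma card_inverse_roots (g : {poly int}) (N c D : nat) (V : {set 'I_N.+1}) :
  (size g <= N.+1)%N -> g.[1] ^+ 2 != 1 ->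
  (forall v, v \in V -> 'X^v + g \is monic) ->
  (forall v x, v \in V -> root (pZtoC ('X^v + g)) x -> `|x| <= c%:R) ->
  (forall v, v \in V -> exists z : algC, [/\ z != 0, not_unity z,
     root (pZtoC ('X^v + g)) z & root (pZtoC ('X^v + g)) z^-1]) ->
  (#|V| * D <= small_poly_count c D * D + N.*2)%N.
Proof.
move=> sg g1 monV leV rootV.
have rootE v x : root (pZtoC ('X^v + g)) x = (x ^+ v == - (pZtoC g).[x]).
  by rewrite rmorphD /= map_polyXn /root hornerD hornerXn addr_eq0.
(* The value of [P] at 1 is g(1)^2 - 1, so the hypothesis on [g.[1]] makes [P] nonzero. *)
pose P := g * recip N g - 'X^N.
have P0 : P != 0.
  apply: contraNneq g1 => P0; rewrite -subr_eq0.
  have : P.[1] = 0 by rewrite P0 horner0.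
  by rewrite /P hornerD hornerN hornerM horner1_recip // hornerXn expr1n -expr2 => ->.
have sP : (size P <= N.*2.+1)%N.
  rewrite (leq_trans (size_polyD _ _)) // geq_max size_polyN size_polyXn.
  rewrite ltnS -addnn leq_addr andbT (leq_trans (size_polyMleq _ _)) //.
  by rewrite -(subn1 (_ + _)) leq_subLR add1n -addSn -addnS leq_add // size_recip.
have PCz z : z != 0 -> (pZtoC P).[z] = z ^+ N * ((pZtoC g).[z] * (pZtoC g).[z^-1] - 1).
  move=> z0; rewrite rmorphB rmorphM /= map_polyXn map_recip !hornerE.
  by rewrite horner_recip ?size_pZtoC // mulrBr mulr1 mulrCA.
have [r Dr] := closed_field_poly_normal (pZtoC P).
have PC0 : pZtoC P != 0 by rewrite -size_poly_gt0 size_pZtoC size_poly_gt0.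
pose rs := undup r.
have rsP x : (x \in rs) = root (pZtoC P) x.
  by rewrite mem_undup Dr rootZ ?lead_coef_eq0 // root_prod_XsubC.
have srs : (size rs <= N.*2)%N.
  rewrite (leq_trans (size_undup _)) // -ltnS (leq_trans _ sP) //.
  by rewrite -size_pZtoC Dr size_scale ?lead_coef_eq0 // size_prod_XsubC.
pose a (v : 'I_N.+1) (x : algC) :=
  [&& x != 0, `[< not_unity x >] & root (pZtoC ('X^v + g)) x].
(* A root satisfies x^v = - g(x), and the powers of [x] are pairwise distinct, so [x] determines
   [v]. *)
have a_inj x : {in setT &, forall i j, a i x -> a j x -> i = j}.
  move=> i j _ _ /and3P[x0 /asboolP ux]; rewrite rootE => /eqP xi /and3P[_ _].
  rewrite rootE => /eqP xj; apply/val_inj/(not_unity_exp_inj x0 ux).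
  by rewrite /= xi xj.
pose V1 := [set v in V | (D <= count (a v) rs)%N]; pose V2 := V :\: V1.
have cardV1 : (#|V1| * D <= N.*2)%N.
  apply: leq_trans srs; apply: (disjoint_classes_leq (a := a)).
    by move=> x i j _ _; apply: a_inj; rewrite inE.
  by move=> v; rewrite inE => /andP[].
suff cardV2 : (#|V2| <= small_poly_count c D)%N.
  rewrite -(cardsID V1 V) -/V2 mulnDl addnC leq_add ?leq_mul2r ?cardV2 ?orbT //.
  apply: leq_trans cardV1; rewrite leq_mul2r; apply/orP; right.
  by rewrite subset_leq_card // subsetIr.
(* Each [v] with fewer than [D] roots is labelled by the integer minimal polynomial of one of them.
   The guard [v \in V2] lets [choice] produce a total function. *)
pose Q (v : 'I_N.+1) (w : {poly int}) := v \in V2 ->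
  [/\ (size w <= D.+1)%N, (forall j, `|w`_j| <= (c.+1 ^ D)%N%:R)
    & exists z : algC, a v z /\ pZtoC w = minCpoly z].
have exQ v : exists w, Q v w.
  have [vV2 | nvV2] := boolP (v \in V2); last by exists 0; rewrite /Q (negbTE nvV2).
  have [vV nvV1] : v \in V /\ v \notin V1 by move: vV2; rewrite inE andbC => /andP.
  have [z [z0 uz zF ziF]] := rootV v vV.
  have Pz : root (pZtoC P) z.
    move: zF ziF; rewrite !rootE exprVn => /eqP zF /eqP ziF.
    rewrite /root PCz // -[X in X * _ - _]opprK -[X in _ * X - _]opprK -zF -ziF.
    by rewrite mulrNN divff ?subrr ?mulr0 // expf_neq0.
  have [w Dw] := minCpoly_int (monV v vV) zF.
  have [s Ds] := closed_field_poly_normal (minCpoly z).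
  move: Ds; rewrite (monicP (minCpoly_monic z)) scale1r => Ds.
  have s_root x : x \in s -> root (minCpoly z) x by rewrite Ds root_prod_XsubC.
  (* The conjugates of [z] are distinct roots of [P] in the class of [v], so their number, the
     degree of [z], is bounded by the size of that class. *)
  have szs : (size s <= count (a v) rs)%N.
    rewrite -size_filter; apply: uniq_leq_size (minCpoly_separable Ds) _ => x xs.
    have zx := s_root x xs.
    rewrite mem_filter rsP (dvd_minCpoly Pz zx) andbT /a (dvd_minCpoly zF zx) andbT.
    apply/andP; split; last exact/asboolP/(not_unity_conj uz zx).
    have := root_minCpoly_iff 'X zx.
    by rewrite /= map_polyX /root !hornerX (negbTE z0) => ->.
  have szD : (size s <= D)%N.
    apply: leq_trans szs _; rewrite leqNgt; apply: contra nvV1 => lt.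
    by rewrite inE vV ltnW.
  exists w => _; split.
  - by rewrite -size_pZtoC Dw Ds size_prod_XsubC.
  - move=> j; rewrite -(ler_int algC) intr_norm -coef_map /= Dw Ds.
    apply: le_trans (@coef_prod_XsubC_le _ c%:R _ _ _ _) _; rewrite ?ler0n //.
      by move=> x /s_root/(dvd_minCpoly zF); apply: leV.
    by rewrite natr1 -natrX rmorph_nat ler_nat leq_pexp2l.
  - by exists z; split=> //; apply/and3P; split=> //; apply/asboolP.
have [w wQ] := choice exQ.
apply: (@card_bounded_polys _ V2 w).
(* Equal labels make [z] a conjugate of [x], hence a root belonging to both [i] and [j]. *)
- move=> i j iV jV eqw.
  have [_ _ [z [az Dz]]] := wQ i iV; have [_ _ [x [ax Dx]]] := wQ j jV.
  apply: (a_inj z i j _ _ az); rewrite ?inE //.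
  have xz : root (minCpoly x) z by rewrite -Dx -eqw Dz root_minCpoly.
  have /and3P[_ _ xF] := ax.
  move: az => /and3P[z0 uz _]; apply/and3P; split=> //.
  exact: dvd_minCpoly xF xz.
- by move=> i /wQ[].
- by move=> i j /wQ[].
Qed.

(** * Counting tuples *)

Definition upd (I T : finType) (t : {ffun I -> T}) (i : I) (v : T) : {ffun I -> T} :=
  [ffun j => if j == i then v else t j].

(** Exchanging [v] with the coordinate [t i] is an involution [h] on pairs [(t, v)]; it carries the
    pairs with [t] in [A] into those with [upd t i v] in [A], which are counted fibre by fibre. *)
Lemma card_fibers_le (I T : finType) (A : {set {ffun I -> T}}) (i : I) (c : nat) :
  (forall t, #|[set v | upd t i v \in A]| <= c)%N ->
  (#|A| * #|T| <= c * #|T| ^ #|I|)%N.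
Proof.
move=> fibA; pose S := [set p : {ffun I -> T} * T | upd p.1 i p.2 \in A].
pose h (p : {ffun I -> T} * T) := (upd p.1 i p.2, p.1 i).
have hK : involutive h.
  move=> [t v]; rewrite /h /= !ffunE eqxx; congr (_, _).
  by apply/ffunP => j; rewrite !ffunE; case: eqP => // ->.
have -> : (#|A| * #|T|)%N = #|h @: setX A setT|.
  by rewrite card_imset ?cardsX ?cardsT //; exact: inv_inj.
apply: (@leq_trans #|S|).
  apply/subset_leq_card/subsetP => _ /imsetP[[t v] tA ->].
  move: tA; rewrite !inE andbT /= => tA.
  suff -> : upd (upd t i v) i (t i) = t by [].
  by apply/ffunP => j; rewrite !ffunE; case: eqP => // ->.
rewrite -sum1_card (eq_bigl (fun p => xpredT p.1 && (upd p.1 i p.2 \in A))); last first.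
  by move=> p; rewrite inE.
rewrite -(pair_big_dep xpredT (fun t v => upd t i v \in A) (fun _ _ => 1%N)) /=.
rewrite mulnC -card_ffun -sum_nat_const; apply: leq_sum => t _.
by apply: leq_trans (fibA t); rewrite -sum1_card; under [leqRHS]eq_bigl do rewrite inE.
Qed.

Lemma sum_count_mem (T : finType) (l : seq T) : (\sum_(x : T) count_mem x l)%N = size l.
Proof.
elim: l => [|a l IH]; first by rewrite big1.
rewrite /= big_split /= IH (bigD1 a) //= eqxx big1 // => x xa.
by rewrite eq_sym (negbTE xa).
Qed.

Lemma big_count_mem (T : eqType) (f : T -> nat) (x : T) (l : seq T) :
  (\sum_(y <- l) f y = count_mem x l * f x + \sum_(y <- l | y != x) f y)%N.
Proof.
elim: l => [|a l IH]; first by rewrite !big_nil.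
by rewrite !big_cons IH /=; case: eqVneq => [->|_] /=; lia.
Qed.

(** Index 0 carries the exponent of the constant term, so that [F] becomes a sum of [k.+1]
    monomials. *)
Definition exponents k N (t : {ffun 'I_k -> 'I_N.+1}) (i : 'I_k.+1) : nat :=
  if unlift ord0 i is Some j then t j else 0%N.

Lemma exponents_lift k N (t : {ffun 'I_k -> 'I_N.+1}) j :
  exponents t (lift ord0 j) = t j.
Proof. by rewrite /exponents liftK. Qed.

Lemma exponents0 k N (t : {ffun 'I_k -> 'I_N.+1}) : exponents t ord0 = 0%N.
Proof. by rewrite /exponents unlift_none. Qed.

Lemma exponent_poly_exponents k N (t : {ffun 'I_k -> 'I_N.+1}) :
  exponent_poly (exponents t) = Fpoly t.
Proof.
rewrite /exponent_poly /Fpoly big_ord_recl exponents0 expr0; congr (_ + _).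
by apply: eq_bigr => i _; rewrite exponents_lift.
Qed.

Lemma exponents_incr k N (t : {ffun 'I_k -> 'I_N.+1}) :
  admissible t -> {homo exponents t : i j / (i < j)%N}.
Proof.
case/andP => /forallP t0 /forallP tlt i j.
case: (unliftP ord0 j) => [j' ->|-> //]; rewrite exponents_lift.
case: (unliftP ord0 i) => [i' ->|-> _]; rewrite ?exponents0 ?t0 // exponents_lift.
by rewrite /= /bump /= !add1n ltnS => ij; have /forallP/(_ j')/implyP := tlt i'; apply.
Qed.

Definition relation_set k N (p : 3.-tuple 'I_k.+1 * 3.-tuple 'I_k.+1) :=
  [set t : {ffun 'I_k -> 'I_N.+1} |
    (\sum_(i <- p.1) exponents t i == \sum_(i <- p.2) exponents t i)%N].

(** Some coordinate [t j] has different multiplicities on the two sides, so the relation is a linear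
    equation that determines [t j] from the other coordinates. *)
Lemma card_relation_set k N (p : 3.-tuple 'I_k.+1 * 3.-tuple 'I_k.+1) :
  ~~ perm_eq p.1 p.2 -> (#|relation_set N p| * N.+1 <= N.+1 ^ k)%N.
Proof.
case: p => l1 l2 /= nperm.
(* If the multiplicities agreed at every nonzero index, they would agree at index 0 as well, because
   both tuples have length 3. *)
have [j cj] : exists j : 'I_k, count_mem (lift ord0 j) l1 != count_mem (lift ord0 j) l2.
  apply/existsP; apply: contraNT nperm => /existsPn cj.
  have {}cj j : count_mem (lift ord0 j) l1 = count_mem (lift ord0 j) l2.
    by apply/eqP; move: (cj j); rewrite negbK.
  apply/allP => x _; apply/eqP; case: (unliftP ord0 x) => [j -> //|->].
  have := etrans (sum_count_mem l1) (etrans (size_tuple l1) (esym (size_tuple l2))).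
  rewrite -(sum_count_mem l2) !big_ord_recl.
  by rewrite (eq_bigr (fun j => count_mem (lift ord0 j) l2)) // => /addIn.
have sumE (l : 3.-tuple 'I_k.+1) t v :
    (\sum_(i <- l) exponents (upd t j v) i = count_mem (lift ord0 j) l * v +
      \sum_(i <- l | i != lift ord0 j) exponents t i)%N.
  rewrite (big_count_mem _ (lift ord0 j)) exponents_lift ffunE eqxx; congr (_ + _)%N.
  apply: eq_bigr => i; case: (unliftP ord0 i) => [j' ->|->]; last by rewrite !exponents0.
  by rewrite !exponents_lift ffunE (inj_eq lift_inj) => /negbTE ->.
have := @card_fibers_le _ _ (relation_set N (l1, l2)) j 1.
rewrite !card_ord mul1n; apply => t.
apply/card_le1_eqP => v v'; rewrite !inE !sumE /= => /eqP e1 /eqP e2.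
apply/val_inj => /=; move: cj e1 e2.
move: (count_mem _ l1) (count_mem _ l2) (\sum_(i <- l1 | _) _)%N (\sum_(i <- l2 | _) _)%N.
by move=> a b x y /eqP ab e1 e2; nia.
Qed.

Definition inverse_root_set k N :=
  [set t : {ffun 'I_k -> 'I_N.+1} | admissible t &&
    `[< exists z : algC, [/\ z != 0, not_unity z,
          root (pZtoC (Fpoly t)) z & root (pZtoC (Fpoly t)) z^-1] >] ].

Lemma bad_cover k N (t : {ffun 'I_k.+1 -> 'I_N.+1}) : bad t ->
  t \in inverse_root_set k.+1 N \/ 
  exists2 p : 3.-tuple 'I_k.+2 * 3.-tuple 'I_k.+2, ~~ perm_eq p.1 p.2 & t \in relation_set N p.
Proof.
case/andP => adm /asboolP[G [ncG redG]].
have incr := exponents_incr adm.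
have [gs | ngs] := pselect (sum3_generic (exponents t)); [left | right].
  rewrite inE adm; apply/asboolP; rewrite -exponent_poly_exponents.
  apply: reducible_inverse_roots redG => //; rewrite ?exponent_poly_exponents //.
  - exact: exponents0.
  - by rewrite -(exponents0 t) incr.
  - move=> i j eij; apply/val_inj => /=.
    by case: (ltngtP i j) => // /incr; rewrite eij ltnn.
  - move=> i; have [/incr/ltnW // | mi] := ltnP i (ord_max : 'I_k.+2).
    by rewrite (_ : i = ord_max) //; apply/val_inj/eqP; rewrite eqn_leq -ltnS ltn_ord.
move/existsNP: ngs => [l1 /existsNP[l2 /not_implyP[e /negP nperm]]].
by exists (l1, l2); rewrite // inE e.
Qed.

(** When |x| > 1, each of the [#|P|.+1] terms on the right has modulus at most |x|^(v-1), and this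
    power can be divided out. *)
Lemma root_norm_le (R : numFieldType) (I : finType) (P : pred I) (e : I -> nat) (v : nat) (x : R) :
  (0 < v)%N -> (forall i, P i -> (e i < v)%N) ->
  x ^+ v = - (1 + \sum_(i | P i) x ^+ e i) -> `|x| <= #|P|.+1%:R.
Proof.
move=> v0 ev xv; have [x1 | x1] := real_leP (normr_real x) (@real1 R).
  by rewrite (le_trans x1) // ler1n.
have x0 : 0 < `|x| := lt_trans ltr01 x1.
have bound n : (n < v)%N -> `|x ^+ n| <= `|x| ^+ v.-1.
  by move=> nv; rewrite normrX ler_eXn2l // -ltnS prednK.
rewrite -(ler_pM2r (exprn_gt0 v.-1 x0)) -exprS prednK // -normrX xv normrN.
apply: le_trans (ler_normD _ _) _; rewrite -natr1 mulrDl mul1r addrC.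
apply: lerD; last by have := bound 0%N v0; rewrite expr0.
apply: le_trans (ler_norm_sum _ _ _) _.
rewrite mulr_natl -sumr_const; apply: ler_sum => i Pi; exact/bound/ev.
Qed.

Lemma card_inverse_root_set k N D : (0 < D)%N ->
  (#|inverse_root_set k.+2 N| * N.+1 <=
   (small_poly_count k.+2 D + N.*2 %/ D) * N.+1 ^ k.+2)%N.
Proof.
move=> D0; have := @card_fibers_le _ _ (inverse_root_set k.+2 N) ord_max.
rewrite !card_ord; apply => u.
set V := [set v | _].
pose g : {poly int} := 1 + \sum_(i < k.+2 | i != ord_max) 'X^(u i).
have FE v : Fpoly (upd u ord_max v) = 'X^v + g.
  rewrite /Fpoly /g (bigD1 ord_max) //= ffunE eqxx addrCA; congr (_ + (_ + _)).
  by apply: eq_bigr => i /negbTE ni; rewrite ffunE ni.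
have admV v : v \in V -> (0 < v)%N /\ (forall i, i != ord_max -> (u i < v)%N).
  rewrite !inE => /andP[/andP[/forallP t0 /forallP tlt] _]; split.
    by have := t0 ord_max; rewrite ffunE eqxx.
  move=> i ni; have /forallP/(_ ord_max)/implyP := tlt i.
  rewrite !ffunE eqxx (negbTE ni); apply.
  by rewrite ltn_neqAle -ltnS ltn_ord andbT; apply: contra ni => /eqP E; apply/eqP/val_inj.
have sg n : (0 < n)%N -> (forall i, i != ord_max -> (u i < n)%N) -> (size g <= n)%N.
  move=> n0 un; rewrite (leq_trans (size_polyD _ _)) // geq_max size_poly1 n0.
  apply: (leq_trans (size_sum _ _ _)); apply/bigmax_leqP => i ni.
  by rewrite size_polyXn un.
rewrite -divnMDl // leq_divRL //; apply: (card_inverse_roots (g := g)).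
- by apply: sg => // i _; exact: ltn_ord.
(* Here g(1) = k + 2: the constant term and [k.+1] monomials. *)
- rewrite /g hornerD hornerC horner_sum; under eq_bigr do rewrite hornerXn expr1n.
  have -> : (\sum_(i < k.+2 | i != ord_max) 1 : int) = k.+1%:R.
    by rewrite sumr_const -[#|_|]/#|predC1 _| cardC1 card_ord.
  by rewrite -natr1 expr2; move: (k%:R) (ler0n int k) => x x0; nia.
- move=> v /admV[v0 uv]; rewrite monicE lead_coefDl ?lead_coefXn // size_polyXn ltnS.
  exact: sg.
- move=> v x /admV[v0 uv]; rewrite rmorphD /= map_polyXn /root hornerD hornerXn addr_eq0.
  rewrite /g rmorphD rmorph1 /= rmorph_sum /= hornerD hornerC horner_sum => /eqP xv.
  have := @root_norm_le algC _ [pred i | i != ord_max] (fun i => u i) v x v0 uv.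
  rewrite xv => /(_ _)/le_trans-> //.
    by congr (- (_ + _)); apply: eq_bigr => i _; rewrite map_polyXn hornerXn.
  by rewrite ler_nat -[#|_|]/#|predC1 _| cardC1 card_ord.
- by move=> v; rewrite !inE FE => /andP[_ /asboolP].
Qed.

(** [C] depends on [D] but not on [N], so [D] can be fixed before [N] grows. It collects the number
    of nontrivial relations and the count of small minimal polynomials. *)
Lemma E_le k : exists C : nat -> nat, forall N D : nat, (0 < D)%N ->
  (E k.+2 N <= (C D + N.*2 %/ D) * N.+1 ^ k.+1)%N.
Proof.
pose Q := [set p : 3.-tuple 'I_k.+3 * 3.-tuple 'I_k.+3 | ~~ perm_eq p.1 p.2].
exists (fun D => #|Q| + small_poly_count k.+2 D)%N => N D D0.
pose U := \bigcup_(p in Q) relation_set N p.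
have cardU : (#|U| * N.+1 <= #|Q| * N.+1 ^ k.+2)%N.
  apply: leq_trans (_ : (\sum_(p in Q) #|relation_set N p|) * N.+1 <= _)%N.
    rewrite leq_mul2r; apply/orP; right; rewrite /U.
    elim/big_rec2: _ => [|p n S _ le]; first by rewrite cards0.
    by rewrite (leq_trans (leq_card_setU _ _).1) // leq_add2l.
  rewrite big_distrl -sum_nat_const /=; apply: leq_sum => p; rewrite inE.
  exact: card_relation_set.
rewrite -(leq_pmul2r (ltn0Sn N)) -mulnA -expnSr.
apply: leq_trans (_ : (#|inverse_root_set k.+2 N| + #|U|) * N.+1 <= _)%N.
  rewrite leq_mul2r; apply/orP; right; apply: leq_trans (leq_card_setU _ _).1.
  apply/subset_leq_card/subsetP => t; rewrite !inE => /bad_cover[|[p np tp]].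
    by rewrite !inE => ->.
  by apply/orP; right; apply/bigcupP; exists p => //; rewrite inE.
have := card_inverse_root_set k N D0; rewrite !mulnDl; lia.
Qed.

Theorem theorem2 (k : nat) (hk : (2 <= k)%N) :
  forall eps : rat, 0 < eps ->
  exists N0 : nat, forall N : nat, (N0 <= N)%N ->
    (E k N)%:R <= eps * (N%:R) ^+ k.
Proof.
case: k hk => [|[|k]] // _ eps eps0; have [C EC] := E_le k.
(* After N + 1 <= 2N, each of the two terms of the bound should be at most half of eps N^(k+2): [D]
   is chosen for the term 2N/D, and then [M] for the term [C D]. *)
pose D := (Num.bound (2 ^+ k.+3 / eps)).+1.
pose M := Num.bound (2 ^+ k.+2 * (C D)%:R / eps).
exists M.+1 => N leN; have N0 : 0 < N%:R :> rat by rewrite ltr0n; case: N leN.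
have D0 : 0 < D%:R :> rat by rewrite ltr0n.
have hD : 2 ^+ k.+3 <= eps * D%:R.
  rewrite mulrC -ler_pdivrMr //; apply: ltW.
  apply: lt_trans (archi_boundP _) _; last by rewrite ltr_nat.
  by rewrite divr_ge0 ?exprn_ge0 // ltW.
have hN : 2 ^+ k.+2 * (C D)%:R <= eps * N%:R.
  rewrite mulrC [in leRHS]mulrC -ler_pdivrMr // [_ * 2 ^+ _]mulrC; apply: ltW.
  apply: lt_le_trans (archi_boundP _) _; last by rewrite ler_nat ltnW.
  by rewrite divr_ge0 ?(ltW eps0) // mulr_ge0 // exprn_ge0.
have hq : (N.*2 %/ D)%:R * D%:R <= 2 * N%:R :> rat.
  by rewrite -!natrM ler_nat mul2n leq_trunc_div.
have h1 : (E k.+2 N)%:R <= ((C D)%:R + (N.*2 %/ D)%:R) * (2 * N%:R) ^+ k.+1 :> rat.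
  apply: le_trans (_ : ((C D + N.*2 %/ D) * N.+1 ^ k.+1)%N%:R <= _).
    by rewrite ler_nat EC.
  rewrite natrM natrD natrX; apply: ler_wpM2l; first by rewrite addr_ge0.
  rewrite lerXn2r ?nnegrE ?mulr_ge0 //.
  by rewrite -natrM ler_nat; case: N leN {N0 hN hq} => //; lia.
apply: le_trans h1 _; rewrite exprMn [N%:R ^+ k.+2]exprS !mulrA ler_wpM2r ?exprn_ge0 ?(ltW N0) //.
move: hD hN hq; rewrite !exprS; have := ler0n rat (N.*2 %/ D).
move: (2 ^+ k) (_ %/ D)%:R (C D)%:R (D%:R) (N%:R) => p q c d n q0 hD hN hq.
have := mulr_ge0 q0 (_ : 0 <= eps * d - 2 * (2 * (2 * p))).
have := mulr_ge0 (ltW eps0) (_ : 0 <= 2 * n - q * d).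
rewrite !subr_ge0 => /(_ hq) h1 /(_ hD) h2; nra.
Qed.
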